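(* Let $K$ be a field and let $w$ be a standard linear weighting of $S=K[t_1,\ldots,t_s]$. If $I$ and $J$ are monomial ideals of $S$ and $I_w=J_w$, then $I=J$.
   Context: For $a\in\mathbb{N}^s$ write $t^a=t_1^{a_1}\cdots t_s^{a_s}$. A standard linear weighting is a linear map $w\colon\mathbb{R}^s\to\mathbb{R}^s$ of the form $w(a)=(d_1a_1,\ldots,d_sa_s)$ for some positive integers $d_1,\ldots,d_s$. For a monomial ideal $I$, the weighted monomial ideal is $I_w:=(\{t^{w(a)}\mid t^a\in I\})$. *)

(* Defs.v *)
From HB Require Import structures.
From mathcomp Require Import all_boot all_order all_algebra.
From mathcomp Require Import mpoly.
From mathcomp Require Import boolp classical_sets reals.

Set Implicit Arguments.
Unset Strict Implicit.
Unset Printing Implicit Defensive.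

Import GRing.Theory.
Local Open Scope classical_set_scope.
Local Open Scope ring_scope.

(* The library's [idealr_closed] is not used: it is about boolean predicates
   and excludes the unit ideal. *)
Definition is_ideal (A : comNzRingType) (I : set A) : Prop :=
  [/\ I 0, (forall x y, I x -> I y -> I (x + y))
    & (forall a x, I x -> I (a * x))].

Definition ideal_gen (A : comNzRingType) (G : set A) : set A :=
  smallest (@is_ideal A) G.

Definition is_monomial_ideal (K : fieldType) (s : nat)
    (I : set {mpoly K[s]}) : Prop :=
  exists E : set 'X_{1..s}, I = ideal_gen [set 'X_[a] | a in E].

(* the inclusion of N^s into R^s *)
Definition expvec (R : realType) (s : nat) (a : 'X_{1..s}) : 'rV[R]_s :=
  \row_i (a i)%:R.

Definition standard_linear_weighting (R : realType) (s : nat)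
    (w : {linear 'rV[R]_s -> 'rV[R]_s}) : Prop :=
  exists d : 'I_s -> nat, (forall i, (0 < d i)%N) /\
    forall a : 'rV[R]_s, w a = \row_i ((d i)%:R * a 0 i).

(* [w] acts on R^s whereas exponents live in N^s: t^(w a) is the monomial
   'X_[b] whose exponent b is mapped to w a by the inclusion of N^s into R^s.
   When w is a standard linear weighting, such a b exists and is unique. *)
Definition weighted_ideal (K : fieldType) (R : realType) (s : nat)
    (w : {linear 'rV[R]_s -> 'rV[R]_s}) (I : set {mpoly K[s]}) :
    set {mpoly K[s]} :=
  ideal_gen [set f | exists a b : 'X_{1..s},
    [/\ I 'X_[a], expvec R b = w (expvec R a) & f = 'X_[b]]].

(* Main.v *)
Require Import Defs.
From mathcomp Require Import all_boot all_order all_algebra.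
From mathcomp Require Import mpoly.
From mathcomp Require Import boolp classical_sets reals.

(** A standard linear weighting multiplies the [i]-th exponent by a positive
    integer [d i], so it preserves and reflects the componentwise order on
    exponents, which for monomials is divisibility.  Divisibility in turn
    decides which monomials belong to a monomial ideal: 'X_[b] lies in the ideal
    generated by some monomials only if one of these monomials divides it
    ([monomial_ideal_gen_dvd]).

    If 'X_[a] lies in [I], then its weighting lies in [weighted_ideal w I], hence
    in [weighted_ideal w J], hence is a multiple of the weighting of some
    'X_[a'] in [J].  Reflection of the order shows that 'X_[a'] divides 'X_[a],
    so that 'X_[a] lies in [J].  Thus all monomials of [I] lie in [J]; since [I]
    is generated by monomials, [I] is contained in [J]
    ([weighted_ideal_reflects_subset]), and the situation is symmetric. *)

Import GRing.Theory Num.Theory.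
Local Open Scope classical_set_scope.
Local Open Scope ring_scope.

Lemma ideal_gen_is_ideal (A : comNzRingType) (G : set A) :
  is_ideal (ideal_gen G).
Proof.
split=> [|x y Gx Gy|a x Gx] M [idM sGM]; case: (idM) => M0 MD MM //.
- by apply: MD; [apply: Gx | apply: Gy].
- by apply: MM; apply: Gx.
Qed.

Lemma ideal_gen_sub (A : comNzRingType) (G I : set A) :
  is_ideal I -> G `<=` I -> ideal_gen G `<=` I.
Proof. by move=> idI sGI x; apply. Qed.

Lemma sub_ideal_gen (A : comNzRingType) (G : set A) : G `<=` ideal_gen G.
Proof. by move=> x Gx M [_]; apply. Qed.

Lemma monomial_ideal_is_ideal (K : fieldType) (s : nat) (I : set {mpoly K[s]}) :
  is_monomial_ideal I -> is_ideal I.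
Proof. by case=> E ->; apply: ideal_gen_is_ideal. Qed.

(** An explicit ideal bounding [ideal_gen [set 'X_[a] | a in E]] from above.  It
    absorbs products because exponents add under multiplication and are
    nonnegative, so a multiple of a monomial above [a] is again above [a]. *)
Lemma is_ideal_msupp_above (K : fieldType) (s : nat) (E : set 'X_{1..s}) :
  is_ideal [set p : {mpoly K[s]} |
    forall m, m \in msupp p -> exists2 a, E a & (a <= m)%MM].
Proof.
split=> [m|p q Ip Iq m|p q Iq m] /=.
- by rewrite msupp0.
- by move/msuppD_le; rewrite mem_cat => /orP[/Ip|/Iq].
- move/msuppM_le/allpairsP => [[m1 m2] /= [_ /Iq[a Ea am2] ->]].
  by exists a => //; apply: (lepm_trans am2); apply: lem_addl.
Qed.

(** The ideal of the previous lemma contains the generators, hence 'X_[b], whose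
    only monomial is [b]. *)
Lemma monomial_ideal_gen_dvd (K : fieldType) (s : nat) (E : set 'X_{1..s})
    (b : 'X_{1..s}) :
  ideal_gen [set ('X_[a] : {mpoly K[s]}) | a in E] 'X_[b] ->
  exists2 a, E a & (a <= b)%MM.
Proof.
move=> Eb.
have sub := @ideal_gen_sub _ _ _ (is_ideal_msupp_above K s E).
apply: (sub _ _ _ Eb); last by rewrite msuppX mem_head.
move=> _ [a Ea <-] m; rewrite msuppX inE => /eqP ->.
by exists a => //; apply: lepm_refl.
Qed.

Lemma is_ideal_monomialW (K : fieldType) (s : nat) (I : set {mpoly K[s]})
    (a b : 'X_{1..s}) :
  is_ideal I -> (a <= b)%MM -> I 'X_[a] -> I 'X_[b].
Proof. by move=> [_ _ IM] /submK <- Ia; rewrite mpolyXD; apply: IM. Qed.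

Lemma expvec_weightedP (R : realType) (s : nat)
    (w : {linear 'rV[R]_s -> 'rV[R]_s}) (d : 'I_s -> nat) (a b : 'X_{1..s}) :
  (forall u : 'rV[R]_s, w u = \row_i ((d i)%:R * u 0 i)) ->
  (expvec R b = w (expvec R a)) <-> (forall i, b i = d i * a i)%N.
Proof.
move=> wE; split=> [/rowP ba i|ba].
  by move: (ba i); rewrite wE !mxE -natrM => /eqP; rewrite eqr_nat => /eqP.
by apply/rowP => i; rewrite wE !mxE -natrM ba.
Qed.

Lemma weighted_ideal_reflects_subset (K : fieldType) (R : realType) (s : nat)
    (w : {linear 'rV[R]_s -> 'rV[R]_s}) (I J : set {mpoly K[s]}) :
  standard_linear_weighting w -> is_monomial_ideal I -> is_ideal J ->
  weighted_ideal w I `<=` weighted_ideal w J -> I `<=` J.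
Proof.
move=> [d [d_gt0 wE]] [E IE] idJ sIJ.
rewrite IE; apply: ideal_gen_sub => // _ [a Ea <-].
have Ia : I 'X_[a] by rewrite IE; apply: sub_ideal_gen; exists a.
pose b := [multinom (d i * a i)%N | i < s].
have bE i : b i = (d i * a i)%N by rewrite mnmE.
have /sIJ Jb : weighted_ideal w I 'X_[b].
  by apply: sub_ideal_gen; exists a, b; split=> //; apply/(expvec_weightedP _ _ _ _ _ _ wE).
(* [F] is the set of weighted exponents of [J], so that [weighted_ideal w J] is
   generated by the monomials with exponent in [F]. *)
pose F := [set c | exists2 a', J 'X_[a'] & expvec R c = w (expvec R a')].
have [c [a' Ja' ca'] cb] :
    exists2 c, F c & (c <= b)%MM.
  apply: (monomial_ideal_gen_dvd K); apply: ideal_gen_sub Jb.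
    exact: ideal_gen_is_ideal.
  move=> _ [a' [c [Ja' ca' ->]]]; apply: sub_ideal_gen.
  by exists c => //; exists a'.
have cE := (expvec_weightedP _ _ _ _ _ _ wE).1 ca'.
apply: is_ideal_monomialW Ja' => //; apply/mnm_lepP => i.
by move/mnm_lepP/(_ i): cb; rewrite cE bE leq_pmul2l.
Qed.

Theorem lemma4p4 (K : fieldType) (R : realType) (s : nat)
    (w : {linear 'rV[R]_s -> 'rV[R]_s}) (I J : set {mpoly K[s]})
    (hw : standard_linear_weighting w)
    (hI : is_monomial_ideal I) (hJ : is_monomial_ideal J)
    (hIJ : weighted_ideal w I = weighted_ideal w J) :
  I = J.
Proof.
have [idI idJ] := (monomial_ideal_is_ideal _ _ _ hI,
                   monomial_ideal_is_ideal _ _ _ hJ).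
apply/seteqP; split.
  by apply: (weighted_ideal_reflects_subset _ _ _ w) => //; rewrite hIJ.
by apply: (weighted_ideal_reflects_subset _ _ _ w) => //; rewrite hIJ.
Qed.
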